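(* Let $X$ be a diffeological space and let $F(X)$ be the free diffeological vector space generated by $X$. If $F(X)$ is projective, then $X$ is Hausdorff (in its $D$-topology).
   Context: A diffeological space is a set $X$ together with a specified set of functions $U\to X$ (called plots) for each open set $U\subseteq\mathbb{R}^n$ and each $n\in\mathbb{N}$, such that: (1) every constant function $U\to X$ is a plot; (2) if $U\to X$ is a plot and $V\to U$ is smooth ($V$ open in some $\mathbb{R}^m$), then the composite $V\to U\to X$ is a plot; (3) if $U=\bigcup_i U_i$ is an open cover and $U\to X$ is a function each of whose restrictions $U_i\to X$ is a plot, then $U\to X$ is a plot. A function $f:X\to Y$ between diffeological spaces is smooth if $f\circ p$ is a plot of $Y$ for every plot $p$ of $X$. $\mathbb{R}^n$ carries the standard diffeology (plots are the usual smooth maps). Products carry the product diffeology (plots are the functions all of whose components are plots). A subset $A\subseteq X$ is $D$-open if $p^{-1}(A)$ is open for every plot $p$ of $X$; the $D$-open sets form the $D$-topology. A subduction is a map $f:X\to Y$ such that the plots of $Y$ are exactly the functions $U\to Y$ that locally lift through $f$ to plots of $X$ (in particular $f$ is smooth and surjective). A diffeological vector space is a real vector space $V$ with a diffeology such that addition $V\times V\to V$ and scalar multiplication $\mathbb{R}\times V\to V$ are smooth. $V$ is projective if for every linear subduction $f:W_1\to W_2$ of diffeological vector spaces and every smooth linear map $g:V\to W_2$ there is a smooth linear map $h:V\to W_1$ with $g=f\circ h$. The free diffeological vector space $F(X)$ is the real vector space with basis the elements of $X$, equipped with the smallest (fewest plots) diffeology making it a diffeological vector space and such that the natural map $X\to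 F(X)$ is smooth. *)

(* Defs.v *)
From HB Require Import structures.
From mathcomp Require Import all_boot all_order all_algebra.
From mathcomp Require Import mathcomp_extra boolp classical_sets functions.
From mathcomp Require Import cardinality reals topology normedtype landau derive.

Set Implicit Arguments.
Unset Strict Implicit.
Unset Printing Implicit Defensive.

Import Order.TTheory GRing.Theory Num.Theory numFieldNormedType.Exports.

Local Open Scope classical_set_scope.
Local Open Scope ring_scope.

Record openset (T : topologicalType) := OpenSet {
  openset_set :> set T;
  openset_open : open openset_set
}.

Section SmoothCalculus.
Context {R : realType}.

Fixpoint times_differentiable (k : nat) {V W : normedModType R}
    (U : set V) (f : V -> W) : Prop :=
  if k is k'.+1 then
    (forall x, U x -> differentiable f x) /\
    (forall v, times_differentiable k' U ('D_v f))
  else True.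

(* C^oo on U, phrased for total functions; only meaningful for U open, where
   it depends on the restriction of f to U alone. *)
Definition smooth_on {V W : normedModType R} (U : set V) (f : V -> W) : Prop :=
  forall k, times_differentiable k U f.

Definition smooth_fun {V W : normedModType R} (U : openset V) (f : U -> W)
    : Prop :=
  exists2 g : V -> W, smooth_on U g & forall u : U, f u = g (val u).

Section Lemmas.
Context {V : normedModType R}.
Implicit Types (W : normedModType R) (U : set V).

Lemma times_differentiableW k W U (f : V -> W) :
  times_differentiable k.+1 U f -> times_differentiable k U f.
Proof.
elim: k f => [//|k IH] f [df Hf]; split=> // v.
exact/IH/Hf.
Qed.

Lemma differentiable_near_eq W (f g : V -> W) x :
  (\near x, f x = g x) -> differentiable f x -> differentiable g x.
Proof.
move=> fg df; have fgx : f x = g x by exact: nbhs_singleton fg.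
suff H : g \o shift x = cst (g x) + 'd f x +o_ (0 : V) id.
  have dgf : 'd g x = 'd f x :> (V -> W).
    by apply: diff_unique => //; exact: diff_continuous.
  apply/diff_locallyP; rewrite dgf; split=> //; exact: diff_continuous.
apply/eqaddoP => e e0; have /eqaddoP/(_ e e0) := diff_locally df.
have : \forall h \near (0 : V), f (h + x) = g (h + x).
  by move: fg; rewrite (near_shift 0 x) subr0.
move=> fg0; apply: filterS2 fg0 => h fgh.
by rewrite /= !fctE /= fgx fgh.
Qed.

Lemma near_of_open W U (f g : V -> W) x :
  open U -> (forall y, U y -> f y = g y) -> U x -> \near x, f x = g x.
Proof.
move=> oU fg Ux; near=> y; apply: fg; near: y.
exact: open_nbhs_nbhs.
Unshelve. all: by end_near. Qed.

Lemma eq_times_differentiable k W U (f g : V -> W) : open U ->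
  (forall x, U x -> f x = g x) ->
  times_differentiable k U f -> times_differentiable k U g.
Proof.
move=> oU; elim: k f g => [//|k IH] f g fg [df Hf]; split=> [x Ux|v].
  by apply: differentiable_near_eq (df x Ux); exact: near_of_open Ux.
apply: IH (Hf v) => x Ux.
by apply: near_eq_derive; exact: near_of_open Ux.
Qed.

Lemma times_differentiable_local k W U (f : V -> W) :
  (forall x, U x -> exists2 A : set V, A x & times_differentiable k A f) ->
  times_differentiable k U f.
Proof.
elim: k f => [//|k IH] f H; split=> [x /H[A Ax [df _]]|v]; first exact: df.
apply: IH => x /H[A Ax [_ Hf]]; exists A => //; exact: Hf.
Qed.

Lemma times_differentiable_cst k W U (c : W) :
  open U -> times_differentiable k U (cst c : V -> W).
Proof.
move=> oU; elim: k c => [//|k IH] c; split=> [x _|v].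
  by apply: differentiable_cst.
by apply: eq_times_differentiable (IH 0) => // x _; rewrite derive_cst.
Qed.

Lemma times_differentiableD k W U (f g : V -> W) : open U ->
  times_differentiable k U f -> times_differentiable k U g ->
  times_differentiable k U (f \+ g).
Proof.
move=> oU; elim: k f g => [//|k IH] f g [df Hf] [dg Hg]; split=> [x Ux|v].
  by apply: differentiableD; [exact: df|exact: dg].
apply: eq_times_differentiable (IH _ _ (Hf v) (Hg v)) => // x Ux.
by rewrite [RHS]deriveD//; apply: diff_derivable; [exact: df|exact: dg].
Qed.

Lemma times_differentiableM k U (f g : V -> R) : open U ->
  times_differentiable k U f -> times_differentiable k U g ->
  times_differentiable k U (f \* g).
Proof.
move=> oU; elim: k f g => [//|k IH] f g Hf Hg.
have [[df Hf'] [dg Hg']] := (Hf, Hg); split=> [x Ux|v].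
  by apply: differentiableM; [exact: df|exact: dg].
apply: eq_times_differentiable (times_differentiableD oU
  (IH _ _ (times_differentiableW Hf) (Hg' v))
  (IH _ _ (times_differentiableW Hg) (Hf' v))) => // x Ux.
by rewrite [RHS]deriveM//; apply: diff_derivable; [exact: df|exact: dg].
Qed.

Lemma times_differentiable_sum k W U (I : Type) (r : seq I)
    (F : I -> V -> W) : open U ->
  (forall i, times_differentiable k U (F i)) ->
  times_differentiable k U (fun x => \sum_(i <- r) F i x).
Proof.
move=> oU HF; elim: r => [|i r IH].
  apply: eq_times_differentiable (times_differentiable_cst k 0 oU) => // x _.
  by rewrite big_nil.
apply: eq_times_differentiable (times_differentiableD oU (HF i) IH) => // x _.
by rewrite big_cons.
Qed.

Lemma times_differentiable_coord k n U (f : V -> 'rV[R]_n) j : open U ->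
  times_differentiable k U f ->
  times_differentiable k U (fun x => f x 0 j).
Proof.
move=> oU; elim: k f => [//|k IH] f [df Hf]; split=> [x Ux|v].
  apply: (@differentiable_comp _ _ _ _ f (fun M : 'rV[R]_n => M 0 j)).
    exact: df.
  exact: differentiable_coord.
apply: eq_times_differentiable (IH _ (Hf v)) => // x Ux.
by rewrite derive_mx ?mxE//; apply: diff_derivable; exact: df.
Qed.

End Lemmas.

Lemma derive_comp_rV (V : normedModType R) n (f : V -> 'rV[R]_n)
    (g : 'rV[R]_n -> R) (x v : V) :
  differentiable f x -> differentiable g (f x) ->
  'D_v (g \o f) x = \sum_(j < n) 'D_v f x 0 j * 'D_('e_j) g (f x).
Proof.
move=> df dg; have dgf : differentiable (g \o f) x by exact: differentiable_comp.
rewrite (deriveE _ dgf) diff_comp//= -(deriveE v df).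
rewrite {1}(row_sum_delta ('D_v f x)) linear_sum.
by apply: eq_bigr => j _; rewrite linearZ/= (deriveE _ dg).
Qed.

Lemma times_differentiable_comp k (V : normedModType R) n
    (A : set V) (U : set 'rV[R]_n) (f : V -> 'rV[R]_n) (g : 'rV[R]_n -> R) :
  open A -> open U -> (forall x, A x -> U (f x)) ->
  times_differentiable k A f -> times_differentiable k U g ->
  times_differentiable k A (g \o f).
Proof.
move=> oA oU AU; elim: k g => [//|k IH] g Hf [dg Hg].
have [df Hf'] := Hf; split=> [x Ax|v].
  by apply: differentiable_comp; [exact: df|exact/dg/AU].
have H j : times_differentiable k A (fun x => 'D_v f x 0 j * 'D_('e_j) g (f x)).
  apply: (@times_differentiableM _ _ _ (fun x => 'D_v f x 0 j)
    ('D_('e_j) g \o f)) => //; first exact: times_differentiable_coord (Hf' v).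
  exact: IH (times_differentiableW Hf) (Hg _).
apply: eq_times_differentiable (times_differentiable_sum (index_enum _) oA H).
  exact: oA.
by move=> x Ax; rewrite derive_comp_rV//; [exact: df|exact/dg/AU].
Qed.

End SmoothCalculus.

Record diffeology (R : realType) (T : Type) := Diffeology {
  plot : forall n (U : openset 'rV[R]_n), (U -> T) -> Prop;
  plot_cst : forall n (U : openset 'rV[R]_n) (t : T), plot (fun _ : U => t);
  plot_comp : forall m n (U : openset 'rV[R]_n) (V : openset 'rV[R]_m)
      (p : U -> T) (h : V -> U),
    plot p -> smooth_fun (fun v => val (h v)) -> plot (p \o h);
  plot_glue : forall n (U : openset 'rV[R]_n) (I : Type)
      (c : I -> openset 'rV[R]_n) (cU : forall i, c i `<=` U) (p : U -> T),
    U `<=` \bigcup_i c i -> (forall i, plot (p \o subfun (cU i))) -> plot p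
}.

Definition smooth (R : realType) (T1 T2 : Type) (D1 : diffeology R T1)
    (D2 : diffeology R T2) (f : T1 -> T2) : Prop :=
  forall n (U : openset 'rV[R]_n) (p : U -> T1), plot D1 p -> plot D2 (f \o p).

Section Diffeologies.
Context {R : realType}.

Section RealDiffeology.

Definition real_plot n (U : openset 'rV[R]_n) (p : U -> R) : Prop := smooth_fun p.

Lemma real_plot_cst n (U : openset 'rV[R]_n) (t : R) : real_plot (fun _ : U => t).
Proof.
exists (cst t) => // k; apply: times_differentiable_cst.
exact: openset_open.
Qed.

Lemma real_plot_comp m n (U : openset 'rV[R]_n) (V : openset 'rV[R]_m)
    (p : U -> R) (h : V -> U) :
  real_plot p -> smooth_fun (fun v => val (h v)) -> real_plot (p \o h).
Proof.
move=> [g Hg pg] [f Hf hf]; exists (g \o f) => [k|v]; last first.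
  by rewrite /= pg hf.
apply: (times_differentiable_comp (openset_open V) (openset_open U) _
  (Hf k) (Hg k)) => x Vx.
have := set_valP (h (SigSub (mem_set Vx))).
by rewrite hf.
Qed.

Lemma real_plot_glue n (U : openset 'rV[R]_n) (I : Type)
    (c : I -> openset 'rV[R]_n) (cU : forall i, c i `<=` U) (p : U -> R) :
  U `<=` \bigcup_i c i -> (forall i, real_plot (p \o subfun (cU i))) -> real_plot p.
Proof.
move=> Uc Hp; pose g x := oapp p 0 (insub x).
have gE (u : U) : p u = g (val u) by rewrite /g valK.
exists g => // k; apply: times_differentiable_local => x /Uc[i _ cix].
exists (c i) => //; have [f Hf pf] := Hp i.
apply: eq_times_differentiable (Hf k); first exact: openset_open.
move=> y ciy; have := pf (SigSub (mem_set ciy)).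
by rewrite /= gE/= => ->.
Qed.

Definition real_diffeology : diffeology R R :=
  Diffeology real_plot_cst real_plot_comp real_plot_glue.

End RealDiffeology.

Section ProdDiffeology.
Context {T1 T2 : Type} (D1 : diffeology R T1) (D2 : diffeology R T2).

Definition prod_plot n (U : openset 'rV[R]_n) (p : U -> T1 * T2) : Prop :=
  plot D1 (fst \o p) /\ plot D2 (snd \o p).

Lemma prod_plot_cst n (U : openset 'rV[R]_n) t : prod_plot (fun _ : U => t).
Proof. by split; apply: plot_cst. Qed.

Lemma prod_plot_comp m n (U : openset 'rV[R]_n) (V : openset 'rV[R]_m)
    (p : U -> T1 * T2) (h : V -> U) :
  prod_plot p -> smooth_fun (fun v => val (h v)) -> prod_plot (p \o h).
Proof.
by move=> [p1 p2] sh; split; [exact: (plot_comp p1 sh)|exact: (plot_comp p2 sh)].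
Qed.

Lemma prod_plot_glue n (U : openset 'rV[R]_n) (I : Type)
    (c : I -> openset 'rV[R]_n) (cU : forall i, c i `<=` U)
    (p : U -> T1 * T2) :
  U `<=` \bigcup_i c i -> (forall i, prod_plot (p \o subfun (cU i))) -> prod_plot p.
Proof.
by move=> Uc Hp; split; apply: (plot_glue (cU := cU)) => // i; have [] := Hp i.
Qed.

Definition prod_diffeology : diffeology R (T1 * T2) :=
  Diffeology prod_plot_cst prod_plot_comp prod_plot_glue.

End ProdDiffeology.

Section InfDiffeology.
Context {T : Type} (P : diffeology R T -> Prop).

Definition inf_plot n (U : openset 'rV[R]_n) (p : U -> T) : Prop :=
  forall D, P D -> plot D p.

Lemma inf_plot_cst n (U : openset 'rV[R]_n) t : inf_plot (fun _ : U => t).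
Proof. by move=> D _; apply: plot_cst. Qed.

Lemma inf_plot_comp m n (U : openset 'rV[R]_n) (V : openset 'rV[R]_m)
    (p : U -> T) (h : V -> U) :
  inf_plot p -> smooth_fun (fun v => val (h v)) -> inf_plot (p \o h).
Proof. by move=> Hp sh D PD; exact: (plot_comp (Hp D PD) sh). Qed.

Lemma inf_plot_glue n (U : openset 'rV[R]_n) (I : Type)
    (c : I -> openset 'rV[R]_n) (cU : forall i, c i `<=` U) (p : U -> T) :
  U `<=` \bigcup_i c i -> (forall i, inf_plot (p \o subfun (cU i))) -> inf_plot p.
Proof. by move=> Uc Hp D PD; apply: (plot_glue (cU := cU)) => // i; exact: Hp. Qed.

(* The intersection of all the diffeologies satisfying P; it is the smallest
   of them as soon as it satisfies P itself. *)
Definition inf_diffeology : diffeology R T :=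
  Diffeology inf_plot_cst inf_plot_comp inf_plot_glue.

End InfDiffeology.

Definition subduction {T1 T2 : Type} (D1 : diffeology R T1)
    (D2 : diffeology R T2) (f : T1 -> T2) : Prop :=
  forall n (U : openset 'rV[R]_n) (p : U -> T2),
    plot D2 p <->
    forall u : U, exists (V : openset 'rV[R]_n) (VU : V `<=` U) (q : V -> T1),
      [/\ openset_set V (val u), plot D1 q & f \o q =1 p \o subfun VU].

Definition vector_diffeology (V : lmodType R) (D : diffeology R V) : Prop :=
  smooth (prod_diffeology D D) D (fun z => z.1 + z.2) /\
  smooth (prod_diffeology real_diffeology D) D (fun z => z.1 *: z.2).

End Diffeologies.

HB.mixin Record hasDiffeology (R : realType) T := {
  diffeo : diffeology R T
}.

#[short(type="diffeologicalType")]
HB.structure Definition Diffeological (R : realType) :=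
  {T of hasDiffeology R T & Choice T}.

Arguments diffeo {R} s.

HB.mixin Record isDiffeologicalVector (R : realType) V
    & Diffeological R V & GRing.Lmodule R V := {
  diffeo_vector : vector_diffeology (diffeo V)
}.

#[short(type="diffeologicalVectType")]
HB.structure Definition DiffeologicalVector (R : realType) :=
  {V of isDiffeologicalVector R V & Diffeological R V & GRing.Lmodule R V}.

Definition projective (R : realType) (V : diffeologicalVectType R) : Prop :=
  forall (W1 W2 : diffeologicalVectType R) (f : {linear W1 -> W2}),
    subduction (diffeo W1) (diffeo W2) f ->
    forall g : {linear V -> W2}, smooth (diffeo V) (diffeo W2) g ->
    exists2 h : {linear V -> W1},
      smooth (diffeo V) (diffeo W1) h & g =1 f \o h.

Section DTopology.
Context {R : realType}.

(* val @` (p @^-1` A) is the preimage of A under p, seen as a subset of R^n. *)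
Definition D_open (X : diffeologicalType R) (A : set X) : Prop :=
  forall n (U : openset 'rV[R]_n) (p : U -> X), plot (diffeo X) p ->
    open ((val : U -> 'rV[R]_n) @` (p @^-1` A)).

Definition D_topology (X : diffeologicalType R) : Type := X.

Context (X : diffeologicalType R).

HB.instance Definition _ := Choice.on (D_topology X).

Lemma D_openT : D_open (setT : set X).
Proof.
move=> n U p _; rewrite (_ : _ @` _ = U); first exact: openset_open.
apply/seteqP; split=> [_ [u _ <-]|x Ux]; first exact: set_valP.
by exists (SigSub (mem_set Ux)).
Qed.

Lemma D_openI : setI_closed (@D_open X).
Proof.
move=> A B oA oB n U p Hp; rewrite preimage_setI.
rewrite (_ : _ @` _ = (val : U -> 'rV[R]_n) @` (p @^-1` A) `&`
                      (val : U -> 'rV[R]_n) @` (p @^-1` B)).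
  by apply: openI; [exact: oA|exact: oB].
apply/seteqP; split=> [_ [u [Au Bu] <-]|x]; first by split; exists u.
by move=> [[u Au <-] [w Bw /val_inj wu]]; exists u => //; split=> //; rewrite -wu.
Qed.

Lemma D_open_bigcup (I : Type) (A : I -> set X) :
  (forall i, D_open (A i)) -> D_open (\bigcup_i A i).
Proof.
move=> oA n U p Hp; rewrite preimage_bigcup image_bigcup.
by apply: bigcup_open => i _; exact: oA.
Qed.

HB.instance Definition _ := @isOpenTopological.Build (D_topology X)
  (@D_open X) D_openT D_openI D_open_bigcup.

End DTopology.

Section FreeVect.
Context {R : realType}.

Section Carrier.
Context (X : choiceType).

Definition fin_support : {pred X -> R} :=
  [pred f | `[< finite_set [set x | f x != 0] >]].

Lemma fin_support_submod : submod_closed fin_support.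
Proof.
split=> [|a f g /asboolP fF /asboolP gF]; apply/asboolP.
  rewrite (_ : [set _ | _] = set0); first exact: finite_set0.
  by apply/seteqP; split=> x //=; rewrite eqxx.
apply: (@sub_finite_set _ _ ([set x | f x != 0] `|` [set x | g x != 0])).
  move=> x /=; have [fx0|] := eqVneq (f x) 0; last by left.
  by rewrite !fctE fx0 scaler0 add0r; right.
by rewrite finite_setU.
Qed.

HB.instance Definition _ :=
  GRing.isSubmodClosed.Build R (X -> R) fin_support fin_support_submod.

(* The vector space with basis X: the finitely supported functions X -> R. *)
Record free_vect := FreeVect {
  free_coef :> X -> R;
  free_coefP : free_coef \in fin_support
}.

HB.instance Definition _ := [isSub for free_coef].
HB.instance Definition _ := [Choice of free_vect by <:].
HB.instance Definition _ := [SubChoice_isSubLmodule of free_vect by <:].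

Lemma free_basis_subproof (x : X) :
  (fun y => (y == x)%:R : R) \in fin_support.
Proof.
apply/asboolP; apply: (sub_finite_set _ (finite_set1 x)) => y /=.
by have [//|_] := eqVneq y x; rewrite eqxx.
Qed.

Definition free_basis (x : X) : free_vect :=
  FreeVect (free_basis_subproof x).

End Carrier.

Context (X : diffeologicalType R).

Definition free_admissible (D : diffeology R (free_vect X)) : Prop :=
  vector_diffeology D /\ smooth (diffeo X) D (@free_basis X).

Definition free_diffeology : diffeology R (free_vect X) :=
  inf_diffeology free_admissible.

Lemma free_vector_diffeology : vector_diffeology free_diffeology.
Proof.
split=> n U p [p1 p2] D PD; have [[addD scaleD] _] := PD.
  exact: addD (conj (p1 D PD) (p2 D PD)).
exact: scaleD (conj p1 (p2 D PD)).
Qed.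

Lemma smooth_free_basis : smooth (diffeo X) free_diffeology (@free_basis X).
Proof. by move=> n U p Hp D [_]; apply. Qed.

HB.instance Definition _ := hasDiffeology.Build R (free_vect X) free_diffeology.
HB.instance Definition _ :=
  isDiffeologicalVector.Build R (free_vect X) free_vector_diffeology.

End FreeVect.

Arguments free_vect {R} X.

(* Main.v *)
Require Import Defs.
From HB Require Import structures.
From mathcomp Require Import all_boot all_order all_algebra finmap.
From mathcomp Require Import boolp classical_sets functions cardinality fsbigop.
From mathcomp Require Import reals topology normedtype derive.

(** The idea is to produce enough smooth functions on X to separate its points:
if phi : X -> R is smooth then preimages of open sets under phi are D-open, so
two points on which phi differs have disjoint D-open neighbourhoods
([smooth_separated_hausdorff]).

On an arbitrary X there may be no such functions, but there are on its nebula
Y, the disjoint union of the domains of all the plots of X. Distinct points of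
Y either lie in distinct components, which indicator functions tell apart, or
differ in some coordinate of R^n. Multiplying finitely many such functions, and
extending the product linearly to F(Y), one sees that the smooth linear
functionals on F(Y) detect every nonzero vector ([free_nebula_separated]).

Evaluation Y -> X induces a linear map pi : F(Y) -> F(X), and pi is a subduction
([subduction_nebula_map]): the functions into F(X) that locally lift to plots
of F(Y) form a vector space diffeology for which X -> F(X) is smooth, and F(X)
carries the smallest such diffeology. If F(X) is projective, the identity of
F(X) lifts to a smooth linear section h of pi. For x != y in X the vector
h([x] - [y]) is nonzero, because pi maps it to [x] - [y]; a functional l that
does not vanish on it yields the smooth function x |-> l(h([x])) separating x
from y. *)

Set Implicit Arguments.
Unset Strict Implicit.
Unset Printing Implicit Defensive.

Import Order.TTheory GRing.Theory Num.Theory numFieldNormedType.Exports.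

Local Open Scope classical_set_scope.
Local Open Scope ring_scope.

(** * Smooth maps between open sets *)

Section Smoothness.
Context {R : realType}.

Lemma smooth_on_id (V : normedModType R) (U : set V) :
  open U -> smooth_on U (id : V -> V).
Proof.
move=> oU [//|k]; split=> [x _|v]; first exact: ex_diff.
apply: eq_times_differentiable (times_differentiable_cst k v oU) => // x _.
by rewrite derive_id.
Qed.

Lemma smooth_fun_val n (U V : openset 'rV[R]_n) (h : V -> U) :
  (forall v, val (h v) = val v) -> smooth_fun (fun v => val (h v)).
Proof. by move=> hE; exists id => //; apply: smooth_on_id; exact: openset_open. Qed.

Lemma plot_subfun (T : Type) (D : diffeology R T) n (U V : openset 'rV[R]_n)
    (VU : V `<=` U) (p : U -> T) : plot D p -> plot D (p \o subfun VU).
Proof. by move=> Dp; apply: plot_comp Dp _; exact: smooth_fun_val. Qed.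

Lemma open_smooth_preimage (V W : normedModType R) (U : set V) (g : V -> W)
    (A : set W) : open U -> smooth_on U g -> open A -> open (U `&` g @^-1` A).
Proof.
move=> oU /(_ 1%N)[dg _] oA; rewrite openE => x [Ux Agx].
rewrite /interior; apply: filterI; first exact: open_nbhs_nbhs.
by apply: (differentiable_continuous (dg x Ux)); exact: open_nbhs_nbhs.
Qed.

End Smoothness.

(** * Pullback and pushforward of diffeologies *)

Section Constructions.
Context {R : realType}.

(** Pullbacks serve to prove that a map out of an intersection of diffeologies
is smooth: it suffices that the pullback along it is one of those intersected. *)
Section Pullback.
Context {T1 T2 : Type} (D : diffeology R T2) (f : T1 -> T2).

Definition pull_plot n (U : openset 'rV[R]_n) (p : U -> T1) := plot D (f \o p).

Lemma pull_plot_cst n (U : openset 'rV[R]_n) t : pull_plot (fun _ : U => t).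
Proof. exact: (plot_cst D U (f t)). Qed.

Lemma pull_plot_comp m n (U : openset 'rV[R]_n) (V : openset 'rV[R]_m)
    (p : U -> T1) (h : V -> U) :
  pull_plot p -> smooth_fun (fun v => val (h v)) -> pull_plot (p \o h).
Proof. by move=> fp sh; exact: (plot_comp fp sh). Qed.

Lemma pull_plot_glue n (U : openset 'rV[R]_n) (I : Type)
    (c : I -> openset 'rV[R]_n) (cU : forall i, c i `<=` U) (p : U -> T1) :
  U `<=` \bigcup_i c i -> (forall i, pull_plot (p \o subfun (cU i))) -> pull_plot p.
Proof. by move=> Uc Hp; exact: (plot_glue (cU := cU)). Qed.

Definition pull_diffeology : diffeology R T1 :=
  Diffeology pull_plot_cst pull_plot_comp pull_plot_glue.

End Pullback.

(** Surjectivity is what makes constant functions locally lift. *)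
Section Pushforward.
Context {T1 T2 : Type} (D : diffeology R T1) (f : T1 -> T2).
Hypothesis f_surj : forall t, exists s, f s = t.

Definition push_plot n (U : openset 'rV[R]_n) (p : U -> T2) :=
  forall u : U, exists (V : openset 'rV[R]_n) (VU : V `<=` U) (q : V -> T1),
    [/\ openset_set V (val u), plot D q & f \o q =1 p \o subfun VU].

Lemma push_plot_cst n (U : openset 'rV[R]_n) t : push_plot (fun _ : U => t).
Proof.
move=> u; have [s <-] := f_surj t; exists U, (@subset_refl _ U), (fun=> s).
by split=> //; [exact: set_valP|exact: plot_cst].
Qed.

Lemma push_plot_comp m n (U : openset 'rV[R]_n) (V : openset 'rV[R]_m)
    (p : U -> T2) (h : V -> U) :
  push_plot p -> smooth_fun (fun v => val (h v)) -> push_plot (p \o h).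
Proof.
move=> fp [g sg hg] v; have [W [WU [q [Whv Dq fq]]]] := fp (h v).
(* A lift of p near h v is precomposed with h on the part of V that h maps
   into the domain W of that lift. *)
pose A := OpenSet (open_smooth_preimage (openset_open V) sg (openset_open W)).
have AV : A `<=` V by move=> x [].
have AW (a : A) : openset_set W (val (h (subfun AV a))).
  by rewrite hg; have [] := set_valP a.
exists A, AV, (fun a => q (SigSub (mem_set (AW a)))); split.
- by split; [exact: set_valP|rewrite /preimage/= -hg].
- apply: (plot_comp (h := fun a => SigSub (mem_set (AW a))) Dq).
  exists g; last by move=> a /=; rewrite hg.
  move=> k; apply: times_differentiable_local => x [Vx _].
  by exists V => //; exact: sg.
- move=> a /=; have /= -> := fq (SigSub (mem_set (AW a))).
  by congr p; exact: val_inj.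
Qed.

Lemma push_plot_glue n (U : openset 'rV[R]_n) (I : Type)
    (c : I -> openset 'rV[R]_n) (cU : forall i, c i `<=` U) (p : U -> T2) :
  U `<=` \bigcup_i c i -> (forall i, push_plot (p \o subfun (cU i))) -> push_plot p.
Proof.
move=> Uc Hp u; have [i _ ciu] := Uc _ (set_valP u).
have [V [Vc [q [Vu Dq fq]]]] := Hp i (SigSub (mem_set ciu)).
exists V, (subset_trans Vc (cU i)), q; split=> // v; rewrite fq /=.
by congr p; exact: val_inj.
Qed.

Definition push_diffeology : diffeology R T2 :=
  Diffeology push_plot_cst push_plot_comp push_plot_glue.

End Pushforward.

Lemma pull_vector_diffeology (V W : lmodType R) (D : diffeology R W)
    (f : {linear V -> W}) :
  vector_diffeology D -> vector_diffeology (pull_diffeology D f).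
Proof.
move=> [addD scaleD]; split=> n U p [p1 p2].
  rewrite /= /pull_plot (_ : _ \o _ = (fun z => z.1 + z.2) \o
    (fun u => (f (p u).1, f (p u).2))); first by apply: addD; split.
  by apply/funext => u /=; rewrite linearD.
rewrite /= /pull_plot (_ : _ \o _ = (fun z => z.1 *: z.2) \o
  (fun u => ((p u).1, f (p u).2))); first by apply: scaleD; split.
by apply/funext => u /=; rewrite linearZ.
Qed.

Lemma push_vector_diffeology (V W : lmodType R) (D : diffeology R V)
    (f : {linear V -> W}) (f_surj : forall w, exists v, f v = w) :
  vector_diffeology D -> vector_diffeology (push_diffeology D f_surj).
Proof.
(* The two summands lift on neighbourhoods A and B of u, and linearity makes
   the sum of these lifts a lift on the intersection. *)
move=> [addD scaleD]; split=> n U p [p1 p2] u.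
  have [A [AU [q [Au Dq fq]]]] := p1 u; have [B [BU [r [Bu Dr fr]]]] := p2 u.
  pose C := OpenSet (openI (openset_open A) (openset_open B)).
  have CA : C `<=` A by move=> x [].
  have CB : C `<=` B by move=> x [].
  have CU : C `<=` U by move=> x /CA/AU.
  exists C, CU, (fun x => q (subfun CA x) + r (subfun CB x)); split=> //.
    apply: (addD _ _ (fun x => (q (subfun CA x), r (subfun CB x)))).
    by split; [exact: plot_subfun Dq|exact: plot_subfun Dr].
  move=> x /=; rewrite linearD; have /= -> := fq (subfun CA x).
  have /= -> := fr (subfun CB x).
  by congr ((p _).1 + (p _).2); exact: val_inj.
have [A [AU [q [Au Dq fq]]]] := p2 u.
exists A, AU, (fun x => (p (subfun AU x)).1 *: q x); split=> //.
  apply: (scaleD _ _ (fun x => ((p (subfun AU x)).1, q x))).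
  by split; [exact: plot_subfun p1|].
by move=> x /=; rewrite linearZ; have /= -> := fq x.
Qed.

(** * Real-valued plots *)

Lemma real_plotD n (U : openset 'rV[R]_n) (p q : U -> R) :
  real_plot p -> real_plot q -> real_plot (fun u => p u + q u).
Proof.
move=> [f sf pf] [g sg qg]; exists (f \+ g) => [k|u]; last by rewrite pf qg.
by apply: times_differentiableD (sf k) (sg k); exact: openset_open.
Qed.

Lemma real_plotM n (U : openset 'rV[R]_n) (p q : U -> R) :
  real_plot p -> real_plot q -> real_plot (fun u => p u * q u).
Proof.
move=> [f sf pf] [g sg qg]; exists (f \* g) => [k|u]; last by rewrite pf qg.
by apply: times_differentiableM (sf k) (sg k); exact: openset_open.
Qed.

Lemma real_vector_diffeology : @vector_diffeology R R^o real_diffeology.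
Proof.
by split=> n U p [p1 p2]; [exact: real_plotD p1 p2|exact: real_plotM p1 p2].
Qed.

Lemma real_plot_coord n (U : openset 'rV[R]_n) (i : 'I_n) :
  real_plot (fun u : U => val u 0 i).
Proof.
exists (fun x : 'rV[R]_n => x 0 i) => // k.
apply: times_differentiable_coord (smooth_on_id _ k); exact: openset_open.
Qed.

End Constructions.

(** * Linear maps out of the free vector space *)

Section FreeLift.
Context {R : realType} {X : choiceType} {V : lmodType R}.

(** The linear extension of f; the sum over all of X makes sense because v has
finite support. *)
Definition free_lift (f : X -> V) (v : @free_vect R X) : V :=
  \sum_(x \in setT) free_coef v x *: f x.

Lemma free_support (v : @free_vect R X) :
  exists A : {fset X}, forall x, x \notin A -> free_coef v x = 0.
Proof.
have /asboolP fv := free_coefP v.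
exists (fset_set [set x | free_coef v x != 0]) => x.
by rewrite in_fset_set// notin_setE => /negP; rewrite negbK => /eqP.
Qed.

Lemma free_liftE (A : {fset X}) (f : X -> V) (v : @free_vect R X) :
  (forall x, x \notin A -> free_coef v x = 0) ->
  free_lift f v = \sum_(x <- A) free_coef v x *: f x.
Proof. by move=> vA; apply: fsbigTE => x /vA ->; rewrite scale0r. Qed.

Lemma free_lift_linear (f : X -> V) : linear (free_lift f).
Proof.
move=> a u v; have [A uA] := free_support u; have [B vB] := free_support v.
have uAB x : x \notin (A `|` B)%fset -> free_coef u x = 0.
  by rewrite in_fsetU negb_or => /andP[/uA].
have vAB x : x \notin (A `|` B)%fset -> free_coef v x = 0.
  by rewrite in_fsetU negb_or => /andP[_ /vB].
rewrite !(@free_liftE (A `|` B)%fset)//; last first.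
  by move=> x xAB; rewrite /= !fctE uAB// vAB// scaler0 addr0.
rewrite scaler_sumr -big_split; apply: eq_bigr => x _ /=.
by rewrite !fctE scalerDl scalerA.
Qed.

HB.instance Definition _ (f : X -> V) :=
  GRing.isLinear.Build R (@free_vect R X) V _ (free_lift f) (free_lift_linear f).

Lemma free_lift_basis (f : X -> V) x : free_lift f (free_basis x) = f x.
Proof.
rewrite (@free_liftE [fset x]%fset); first by rewrite big_seq_fset1 /= eqxx scale1r.
by move=> y; rewrite in_fset1 /= => /negPf ->.
Qed.

End FreeLift.

Lemma free_span (R : realType) (X : choiceType) (v : @free_vect R X) :
  free_lift (@free_basis R X) v = v.
Proof.
have [A vA] := free_support v; apply/val_inj/funext => y /=.
rewrite (free_liftE _ vA).
have sumE (s : seq X) : free_coef (\sum_(x <- s) free_coef v x *: free_basis x) y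
    = \sum_(x <- s) free_coef v x * (y == x)%:R.
  by elim: s => [|x s IH]; rewrite ?big_nil ?big_cons//= !fctE IH.
(* Both sides vanish outside the support; at y in A only the term of y remains. *)
rewrite sumE; have [yA|/[dup] yA /vA ->] := boolP (y \in A).
  rewrite (big_fsetD1 y)//= eqxx mulr1 big1_fset ?addr0// => x.
  by rewrite in_fsetD1 eq_sym => /andP[/negPf -> _]; rewrite mulr0.
rewrite big1_seq// => x /andP[_ xA]; case: eqP => [yx|_]; last by rewrite mulr0.
by rewrite yx xA in yA.
Qed.

Lemma free_linear_ext (R : realType) (X : choiceType) (V : lmodType R)
    (f g : {linear @free_vect R X -> V}) :
  (forall x, f (free_basis x) = g (free_basis x)) -> f =1 g.
Proof.
move=> fg v; rewrite -(free_span v); have [A vA] := free_support v.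
rewrite (free_liftE _ vA) !linear_sum; apply: eq_bigr => x _.
by rewrite !linearZ fg.
Qed.

Section FreeSmooth.
Context {R : realType} {X : diffeologicalType R}.

(** The universal property of F(X): the pullback of D along the linear extension
of f is a vector space diffeology making X -> F(X) smooth, so it contains the
free diffeology. *)
Lemma smooth_free_lift (V : lmodType R) (D : diffeology R V) (f : X -> V) :
  vector_diffeology D -> smooth (diffeo X) D f ->
  smooth (diffeo (free_vect X)) D (free_lift f).
Proof.
move=> vD sf n U p Fp.
apply: (Fp (pull_diffeology D (free_lift f))); split.
  exact: pull_vector_diffeology.
move=> m W q Xq; rewrite /= /pull_plot (_ : _ \o _ = f \o q); first exact: sf.
by apply/funext => u; rewrite /= free_lift_basis.
Qed.

End FreeSmooth.

(** * The nebula of a diffeological space *)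

Section Nebula.
Context {R : realType} (X : diffeologicalType R).

Record plot_index := PlotIndex {
  plot_dim : nat;
  plot_dom : openset 'rV[R]_plot_dim;
  plot_map : plot_dom -> X;
  plot_mapP : plot (diffeo X) plot_map
}.

Definition nebula := {k : plot_index & plot_dom k}.

HB.instance Definition _ := gen_eqMixin nebula.
HB.instance Definition _ := gen_choiceMixin nebula.

Definition nebula_incl (k : plot_index) : plot_dom k -> nebula := existT _ k.

(** The disjoint union diffeology, obtained as the smallest one for which the
inclusions of the components are plots. *)
Definition nebula_diffeology : diffeology R nebula :=
  inf_diffeology (fun D => forall k, plot D (@nebula_incl k)).

HB.instance Definition _ := hasDiffeology.Build R nebula nebula_diffeology.

Definition nebula_eval (y : nebula) : X := plot_map (projT2 y).

Lemma smooth_nebula (T : Type) (D : diffeology R T) (f : nebula -> T) :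
  (forall k, plot D (f \o @nebula_incl k)) ->
  smooth (diffeo nebula) D f.
Proof. by move=> fk n U p Yp; exact: (Yp (pull_diffeology D f) fk). Qed.

Lemma plot_nebula_incl k : plot (diffeo nebula) (@nebula_incl k).
Proof. by move=> D; apply. Qed.

Definition nebula_map : free_vect nebula -> free_vect X :=
  free_lift (@free_basis R X \o nebula_eval).
HB.instance Definition _ := GRing.Linear.on nebula_map.

Lemma nebula_map_basis y :
  nebula_map (free_basis y) = free_basis (nebula_eval y).
Proof. exact: free_lift_basis. Qed.

(** Every point of X is the value of a constant plot, here one on R^0, so every
basis vector of F(X) is hit. *)
Lemma nebula_map_surj v : exists w, nebula_map w = v.
Proof.
pose U0 : openset 'rV[R]_0 := OpenSet openT.
(* The point of the component of the constant plot x. *)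
pose pt (x : X) : nebula := existT (fun k => plot_dom k)
  (PlotIndex (plot_cst (diffeo X) U0 x)) (SigSub (mem_set (I : openset_set U0 0))).
exists (free_lift (@free_basis R nebula \o pt) v); rewrite -[RHS]free_span.
apply: (@free_linear_ext _ _ _ (nebula_map \o free_lift (free_basis (X:=nebula) \o pt))
 (free_lift _)) => x /=.
by rewrite !free_lift_basis /= nebula_map_basis.
Qed.

Lemma smooth_nebula_map :
  smooth (diffeo (free_vect nebula)) (diffeo (free_vect X)) nebula_map.
Proof.
apply: smooth_free_lift; first exact: free_vector_diffeology.
move=> n U p pp; apply: smooth_free_basis.
by apply: (@smooth_nebula _ (diffeo X) nebula_eval) pp => k; exact: plot_mapP.
Qed.

(** That plots of F(X) lift comes from minimality of the free diffeology: the
pushforward along nebula_map is a vector space diffeology, and it makes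
X -> F(X) smooth because a plot q of X lifts globally, to the inclusion of the
component indexed by q. *)
Lemma subduction_nebula_map :
  subduction (diffeo (free_vect nebula)) (diffeo (free_vect X)) nebula_map.
Proof.
move=> n U p; split=> [Fp|lift].
  apply: (Fp (push_diffeology (diffeo _) nebula_map_surj)); split.
    exact: (push_vector_diffeology nebula_map_surj (@free_vector_diffeology _ _)).
  move=> m W q Xq u; exists W, (@subset_refl _ W).
  exists (@free_basis R nebula \o @nebula_incl (PlotIndex Xq)); split.
  - exact: set_valP.
  - apply: smooth_free_basis; exact: (@plot_nebula_incl (PlotIndex Xq)).
  - move=> w; rewrite /= nebula_map_basis; congr (free_basis (q _)).
    exact: val_inj.
(* Conversely p is a plot on each open set V over which it lifts, and these V
   cover U. *)
pose I := {V : openset 'rV[R]_n & {VU : V `<=` U | plot (diffeo _) (p \o subfun VU)}}.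
apply: (plot_glue (cU := fun i : I => sval (projT2 i))) => [x Ux|]; last first.
  by move=> [V [VU]].
have [V [VU [q [Vx Fq /funext pq]]]] := lift (SigSub (mem_set Ux)).
have Fp : plot (diffeo (free_vect X)) (p \o subfun VU).
  by rewrite -pq; exact: smooth_nebula_map.
by exists (existT _ V (exist _ VU Fp)).
Qed.

(** Extending the j-th coordinate by 0 to the components of dimension at most j
gives one function on the whole nebula, without comparing components of
different dimensions. *)
Definition nebula_coord (j : nat) (y : nebula) : R :=
  if insub j is Some i then val (projT2 y) 0 i else 0.

Lemma smooth_nebula_coord j :
  smooth (diffeo nebula) real_diffeology (nebula_coord j).
Proof.
apply: smooth_nebula => k.
have [jk|kj] := ltnP j (plot_dim k).
  rewrite (_ : _ \o _ = fun u : plot_dom k => val u 0 (Ordinal jk)); first exact: real_plot_coord.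
  by apply/funext => u; rewrite /nebula_coord /= insubT.
rewrite (_ : _ \o _ = fun=> 0); first exact: plot_cst.
by apply/funext => u; rewrite /nebula_coord /= insubF// ltnNge kj.
Qed.

(** Within a component an affine function of a coordinate separates; between
components, the indicator of the component of y does. *)
Lemma nebula_separated (y z : nebula) : y != z ->
  exists2 f, smooth (diffeo nebula) real_diffeology f & f y != 0 /\ f z = 0.
Proof.
case: (pselect (projT1 y = projT1 z)) => [|yz _].
  case: y z => [k u] [l w] /= kl; case: _ / kl in w *.
  move=> uw; have [j uwj] : exists j, val u 0 j != val w 0 j.
    apply/existsP; apply: contraNT uw; rewrite negb_exists => /forallP uw.
    apply/eqP; congr existT; apply/val_inj/rowP => j.
    by have /negPn/eqP := uw j.
  exists (fun x => nebula_coord j x + - nebula_coord j (existT _ k w)).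
    move=> n U p Yp; apply: real_plotD; first exact: smooth_nebula_coord.
    exact: real_plot_cst.
  by rewrite subrr /nebula_coord /= valK subr_eq0.
exists (fun x => (`[< projT1 y = projT1 x >])%:R).
  by apply: smooth_nebula => k; exact: (real_plot_cst _ (`[< projT1 y = k >])%:R).
by rewrite (asboolT erefl) oner_eq0 asboolF.
Qed.

Lemma nebula_separated_seq (y : nebula) (s : seq nebula) : y \notin s ->
  exists2 f, smooth (diffeo nebula) real_diffeology f &
    f y != 0 /\ forall z, z \in s -> f z = 0.
Proof.
elim: s => [_|z s IH]; first by exists (cst 1) => [n U p _|]; [exact: real_plot_cst|split; rewrite ?oner_eq0].
rewrite in_cons negb_or => /andP[/nebula_separated[f sf [fy fz]] /IH[g sg [gy gs]]].
exists (fun x => f x * g x) => [n U p Yp|].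
  by apply: real_plotM; [exact: sf|exact: sg].
split=> [|x]; first by rewrite mulf_neq0.
by rewrite in_cons => /orP[/eqP ->|/gs ->]; rewrite ?fz ?mul0r ?mulr0.
Qed.

(** A smooth function that is nonzero at one point of the support of v and
vanishes at all the others extends to a functional that sees only that term. *)
Lemma free_nebula_separated (v : free_vect nebula) : v != 0 ->
  exists2 l : {linear free_vect nebula -> R^o},
    smooth (diffeo (free_vect nebula)) real_diffeology l & l v != 0.
Proof.
move=> v0; have [A vA] := free_support v.
have [y vy] : exists y, free_coef v y != 0.
  apply/not_existsP => v_0; case/negP: v0; apply/eqP/val_inj/funext => y /=.
  by apply/eqP/negPn/negP; exact: v_0.
have yA : y \in A by apply: contraNT vy => /vA ->.
have yAy : y \notin (A `\ y)%fset by rewrite in_fsetD1 eqxx.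
have [f sf [fy fA]] := nebula_separated_seq yAy.
exists (free_lift (f : nebula -> R^o)).
  exact: smooth_free_lift real_vector_diffeology sf.
rewrite /= (free_liftE _ vA) (big_fsetD1 y)//= big1_seq; last first.
  by move=> x /andP[_ /fA ->]; rewrite scaler0.
by rewrite addr0 mulf_neq0.
Qed.

End Nebula.

(** * The Hausdorff property *)

Lemma smooth_separated_hausdorff (R : realType) (X : diffeologicalType R) :
  (forall x y : X, x != y ->
    exists2 f, smooth (diffeo X) real_diffeology f & f x != f y) ->
  hausdorff_space (D_topology X).
Proof.
move=> sep; rewrite open_hausdorff => x y xy.
have [f sf fxy] := sep _ _ xy.
have openf (A : set R) : open A -> open (f @^-1` A : set (D_topology X)).
  move=> oA; change (D_open (f @^-1` A)) => n U p Xp.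
  have [g sg fg] := sf _ _ _ Xp.
  rewrite (_ : _ @` _ = U `&` g @^-1` A).
    by apply: open_smooth_preimage oA => //; exact: openset_open.
  apply/seteqP; split=> [_ [u Au <-]|z [Uz Az]].
    by split; [exact: set_valP|have /= := fg u; rewrite /preimage/= => <-].
  exists (SigSub (mem_set Uz)) => //.
  by have /= := fg (SigSub (mem_set Uz)); rewrite /preimage/= => ->.
have := @Rhausdorff R; rewrite open_hausdorff => /(_ _ _ fxy).
move=> [[A B] /= [Ax By] [oA oB /eqP AB]].
exists (f @^-1` A, f @^-1` B) => /=.
  by rewrite !inE in Ax By *.
split; [exact: openf|exact: openf|].
by rewrite -preimage_setI AB preimage_set0.
Qed.

Theorem corollary3p17 (R : realType) (X : diffeologicalType R) :
  projective (free_vect X) -> hausdorff_space (D_topology X).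
Proof.
move=> /(_ _ _ _ (@subduction_nebula_map _ X) idfun)[//|h sh hK].
apply: smooth_separated_hausdorff => x y xy.
have [|l sl lxy] := @free_nebula_separated _ X (h (free_basis x - free_basis y)).
  apply/eqP => hxy; have := hK (free_basis x - free_basis y).
  rewrite /= hxy linear0 => /(congr1 (fun v => free_coef v x)) /=.
  by rewrite !fctE /= eqxx (negPf xy) => /eqP; rewrite subr0 oner_eq0.
exists (l \o h \o @free_basis R X) => [n U p Xp|].
  apply: (sl _ _ (h \o (@free_basis R X \o p))); apply: sh.
  exact: smooth_free_basis.
by apply: contraNneq lxy => /= lxy; rewrite !linearB subr_eq0 lxy.
Qed.
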